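(* Let $G=(V,E)$ be a vertex-transitive graph. Then, for all $k\in\mathbb{N}_0$, $$z'_k(G)\leq z_k(G).$$
   Context: Graphs are finite, simple and undirected; $\mathbb{N}_0$ denotes the natural numbers including zero. A graph is vertex-transitive if its automorphism group acts transitively on its vertices. Lovász theta function: for a graph $G=(V,E)$ on $n$ vertices, $$\vartheta(G) = \max\left\{\mathbf{1}_n^T x : \begin{pmatrix} X & x\\ x^T & 1\end{pmatrix}\succeq 0,\ \mathrm{diag}(X)=x,\ X_{ij}=0\ \ \forall \{i,j\}\in E\right\},$$ where $x\in\mathbb{R}^n$, $X\in\mathbb{R}^{n\times n}$ is symmetric, $\mathbf{1}_n$ is the all-ones vector and $\mathrm{diag}(X)$ is the vector of diagonal entries of $X$ (value $0$ for the graph with no vertices). Squared stable set polytope: $\mathrm{STAB}^2(G) = \mathrm{conv}\{ss^T : s\in\{0,1\}^n,\ s_is_j=0\ \forall \{i,j\}\in E\}$. For $I\subseteq V$, $G_I$ is the subgraph of $G$ induced by $I$ and $X_I=(X_{ij})_{i,j\in I}$. Exact subgraph hierarchy: for $0 \le k\le n$, $z_k(G)$ is the optimal value of the semidefinite program $$\max\left\{\mathbf{1}_n^T x : \begin{pmatrix} X & x\\ x^T & 1\end{pmatrix}\succeq 0,\ \mathrm{diag}(X)=x,\ X_{ij}=0\ \ \forall \{i,j\}\in E\right\}$$ with the additional constraints $X_I\in \mathrm{STAB}^2(G_I)$ for all $I\subseteq V$ with $|I|=k$ (for $k=0$ there is no additional constraint, so $z_0(G)=\vartheta(G)$); for $k>n$,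 $z_k(G)=z_n(G)$. Vertex-transitive exact subgraph hierarchy: let $G$ be vertex-transitive with vertex set $V=\{0,\dots,n-1\}$, $n\ge 1$; it is $r$-regular for some $r\in\mathbb{N}_0$. The local graph $G^L$ is the subgraph of $G$ induced by $V^L=V\setminus(\{0\}\cup N(0))$, where $N(0)$ is the set of neighbors of vertex $0$; it has $n-r-1$ vertices. For $k\in\{0,\dots,n-r-1\}$ set $z'_k(G)=1+z_k(G^L)$, and for $k>n-r-1$ set $z'_k(G)=z'_{n-r-1}(G)$. *)

(* Defs.v *)
From HB Require Import structures.
From mathcomp Require Import all_boot all_order all_algebra all_fingroup.
From mathcomp Require Import all_classical all_reals all_analysis.

Set Implicit Arguments.
Unset Strict Implicit.
Unset Printing Implicit Defensive.

Import Order.TTheory GRing.Theory Num.Theory.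

Local Open Scope ring_scope.

Record sgraph (n : nat) := SGraph {
  adj :> rel 'I_n;
  adj_sym : symmetric adj;
  adj_irr : irreflexive adj }.

Definition Aut_sgraph n (G : sgraph n) : {set 'S_n} :=
  [set s : 'S_n | [forall i, forall j, G (s i) (s j) == G i j]]%SET.

Lemma Aut_sgraph_group_set n (G : sgraph n) : group_set (Aut_sgraph G).
Proof.
apply/group_setP; split=> [|s t].
  by rewrite inE; apply/forallP=> i; apply/forallP=> j; rewrite !perm1.
rewrite !inE => /forallP sG /forallP tG; apply/forallP=> i; apply/forallP=> j.
rewrite !permM (eqP (forallP (tG _) _)); exact: (forallP (sG _) _).
Qed.

Canonical Aut_sgraph_group n (G : sgraph n) := Group (Aut_sgraph_group_set G).

Definition vertex_transitive n (G : sgraph n) : Prop :=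
  [transitive Aut_sgraph G, on [set: 'I_n]%SET | 'P]%act.

(* The vertices of I are relabelled 0, ..., #|I|-1 in increasing order, and
   the submatrix X_I below uses the same relabelling. *)
Definition induced n (G : sgraph n) (I : {set 'I_n}) : sgraph #|I| :=
  @SGraph #|I| (fun i j => G (enum_val i) (enum_val j))
    (fun i j => adj_sym G (enum_val i) (enum_val j))
    (fun i => adj_irr G (enum_val i)).

Definition submx_on (R : Type) n (X : 'M[R]_n) (I : {set 'I_n}) : 'M[R]_#|I| :=
  \matrix_(i, j) X (enum_val i) (enum_val j).

Definition psd (R : realType) n (M : 'M[R]_n) : Prop :=
  M^T = M /\ forall v : 'cV[R]_n, 0 <= (v^T *m M *m v) 0 0.

Definition theta_feasible (R : realType) n (G : sgraph n)
    (X : 'M[R]_n) (x : 'cV[R]_n) : Prop :=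
  [/\ psd (block_mx X x x^T 1%:M),
      forall i, X i i = x i 0
    & forall i j, G i j -> X i j = 0].

(* The feasible sets are nonempty and compact, so that the suprema here and in
   [esh] are maxima. *)
Definition lovasz_theta (R : realType) n (G : sgraph n) : R :=
  sup [set t | exists X x, theta_feasible G X x /\ t = \sum_i x i 0]%classic.

Definition convex_hull (R : realType) (M : lmodType R) (A : set M) : set M :=
  smallest (@convex_set R M) A.

Definition stable_vector (R : realType) n (G : sgraph n) (s : 'cV[R]_n) : Prop :=
  (forall i, s i 0 = 0 \/ s i 0 = 1) /\ (forall i j, G i j -> s i 0 * s j 0 = 0).

Definition STAB2 (R : realType) n (G : sgraph n) : set 'M[R]_n :=
  convex_hull [set S | exists s, stable_vector G s /\ S = s *m s^T]%classic.

Definition esh_feasible (R : realType) (k n : nat) (G : sgraph n)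
    (X : 'M[R]_n) (x : 'cV[R]_n) : Prop :=
  theta_feasible G X x /\
  (forall I : {set 'I_n}, #|I| = k -> STAB2 (induced G I) (submx_on X I)).

Definition esh_values (R : realType) (k n : nat) (G : sgraph n) : set R :=
  [set t | exists X x, esh_feasible k G X x /\ t = \sum_i x i 0]%classic.

(* z_k(G): the hierarchy is constant from level n on. *)
Definition esh (R : realType) (k n : nat) (G : sgraph n) : R :=
  sup (@esh_values R (minn k n) n G).

Definition nbhd n (G : sgraph n) (v : 'I_n) : {set 'I_n} :=
  [set w | G v w]%SET.

Definition local_vertices n (G : sgraph n.+1) : {set 'I_n.+1} :=
  (~: (ord0 |: nbhd G ord0))%SET.

Definition local_graph n (G : sgraph n.+1) : sgraph #|local_vertices G| :=
  induced G (local_vertices G).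

(* z'_k(G): constant from level #|V^L| = n - r - 1 on. *)
Definition vt_esh (R : realType) (k n : nat) (G : sgraph n.+1) : R :=
  1 + esh R (minn k #|local_vertices G|) (local_graph G).

Lemma card_local_vertices n (G : sgraph n.+1) :
  #|local_vertices G| = (n.+1 - #|nbhd G ord0| - 1)%N.
Proof.
rewrite /local_vertices cardsCs finset.setCK cardsU1 card_ord inE adj_irr /=.
by rewrite addnC subnDA.
Qed.

Lemma regular_vertex_transitive n (G : sgraph n) (v w : 'I_n) :
  vertex_transitive G -> #|nbhd G v| = #|nbhd G w|.
Proof.
move=> tG; have [s] := atransP2 tG (finset.in_setT v) (finset.in_setT w).
rewrite inE => /forallP sG ->; rewrite /= /aperm.
rewrite -(card_imset (mem (nbhd G v)) (@perm_inj _ s)); congr #|pred_of_set _|.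
apply/setP=> u; rewrite -[u](permKV s) mem_imset; last exact: perm_inj.
by rewrite !inE (eqP (forallP (sG _) _)).
Qed.

Lemma esh_feasible_bound (R : realType) k n (G : sgraph n)
    (X : 'M[R]_n) (x : 'cV[R]_n) :
  esh_feasible k G X x -> forall i, x i 0 <= 1.
Proof.
move=> [[[_ pX] dX _] _] i.
have := pX (col_mx (delta_mx i 0) (- 1)%:M).
rewrite tr_col_mx mul_row_block mul_row_col trmx_delta tr_scalar_mx.
rewrite !mxE !big_ord1.
have -> : \sum_j ((delta_mx 0 i *m X + (-1)%:M *m x^T) 0 j *
                   (delta_mx i 0 : 'cV[R]_n) j 0) = X i i - x i 0.
  rewrite (bigD1 i) //= big1 => [|j ji].
    by rewrite -rowE mul_scalar_mx scaleN1r !mxE !eqxx mulr1 addr0.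
  by rewrite [delta_mx i 0 j 0]mxE (negPf ji) mulr0.
rewrite -rowE mul_scalar_mx scaleN1r !mxE !eqxx dX subrr add0r.
by rewrite mulr1n mulrN1 opprB subr_ge0.
Qed.

Lemma has_sup_esh_values (R : realType) k n (G : sgraph n) :
  has_sup (@esh_values R k n G).
Proof.
split.
  exists 0; exists 0, 0; split; last by rewrite big1 // => i _; rewrite mxE.
  split; first split=> [|i|i j _]; rewrite ?mxE //.
    split; first by rewrite tr_block_mx !trmx0 trmx1.
    move=> v; rewrite -[v]vsubmxK tr_col_mx mul_row_block mul_row_col.
    rewrite trmx0 !mulmx0 !add0r mul0mx add0r mulmx1 mxE big_ord1 mxE.
    exact: sqr_ge0.
  move=> I _; apply: sub_gen_smallest; exists 0; split.
    by split=> [i|i j _]; rewrite !mxE ?mul0r //; left.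
  by apply/matrixP=> i j; rewrite trmx0 mulmx0 !mxE.
exists n%:R => _ [X [x [/esh_feasible_bound x1 ->]]].
rewrite -[n%:R](_ : \sum_(i < n) 1 = n%:R); last by rewrite sumr_const card_ord.
exact: ler_sum.
Qed.

Lemma esh0 (R : realType) n (G : sgraph n) : esh R 0 G = lovasz_theta R G.
Proof.
rewrite /esh min0n; congr sup; apply/seteqP; split=> t [X [x [fX tE]]];
  exists X, x; split=> //; first by case: fX.
split=> // I I0; apply: sub_gen_smallest; exists 0.
have noI (i : 'I_#|I|) : False by case: i => m; rewrite I0.
by split; [split=> i | apply/matrixP=> i]; case: (noI i).
Qed.

(* Main.v *)
(** A stable set of the local graph stays stable in [G] when vertex [0] is
    added. Accordingly, a feasible [X] of the local graph lifts to [G] by giving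
    vertex [0] the bordering row [(x^T, 1)] and its neighbors zero rows; the
    lift has value [1 + \sum_i x i 0]. For [#|I| <= k], the submatrix of the
    lift on [I] is itself the lift of a submatrix of [X] of order
    [minn k #|V^L|], so it lies in [STAB2]. *)

Require Import Defs.
From mathcomp Require Import all_boot all_order all_algebra all_fingroup.
From mathcomp Require Import all_classical all_reals all_analysis.

Set Implicit Arguments.
Unset Strict Implicit.
Unset Printing Implicit Defensive.

Import Order.TTheory GRing.Theory Num.Theory.

Local Open Scope ring_scope.

Lemma exists_superset_card (T : finType) (A : {set T}) (k : nat) :
  (#|A| <= k <= #|T|)%N -> exists2 B : {set T}, A \subset B & #|B| = k.
Proof.
elim: k => [|k IH] /andP[Ak kT].
  by exists A => //; apply/eqP; rewrite -leqn0.
move: Ak; rewrite leq_eqVlt => /predU1P[<-|Ak]; first by exists A.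
have [|B AB Bk] := IH; first by rewrite -ltnS Ak /= ltnW.
have [x] : exists x, x \in (~: B)%SET.
  apply/finset.set0Pn; rewrite -finset.card_gt0 cardsCs finset.setCK Bk.
  by rewrite subn_gt0.
rewrite inE => xB; exists (x |: B)%SET; last by rewrite cardsU1 xB Bk.
exact: fintype.subset_trans AB (finset.subsetUr _ _).
Qed.

Definition pull_mx (R : pzRingType) p q (f : 'I_q -> option 'I_p)
    (M : 'M[R]_p) : 'M[R]_q :=
  \matrix_(a, b)
    (if f a is Some i then if f b is Some j then M i j else 0 else 0).

(** Let column [a] of the 0/1 matrix [P] be the unit vector at [f a], or zero when [f a] is [None].
    Then [pull_mx f M] is the congruence [P^T *m M *m P], which preserves positive
    semidefiniteness. *)
Lemma psd_pull_mx (R : realType) p q (f : 'I_q -> option 'I_p) (M : 'M[R]_p) :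
  psd M -> psd (pull_mx f M).
Proof.
move=> [Mt pM]; pose P : 'M[R]_(p, q) := \matrix_(i, a) (f a == Some i)%:R.
have PMP : pull_mx f M = P^T *m M *m P.
  apply/matrixP=> a b; rewrite !mxE.
  case fa: (f a) => [i|]; last first.
    rewrite big1 // => j _; rewrite !mxE big1 ?mul0r // => i _.
    by rewrite !mxE fa mul0r.
  have PM j : (P^T *m M) a j = M i j.
    rewrite !mxE (bigD1 i) //= !mxE fa eqxx mul1r big1 ?addr0 // => i' ii'.
    by rewrite !mxE fa (inj_eq Some_inj) eq_sym (negPf ii') mul0r.
  case fb: (f b) => [j|]; last first.
    by rewrite big1 // => j _; rewrite !mxE fb mulr0.
  rewrite (bigD1 j) //= PM !mxE fb eqxx mulr1 big1 ?addr0 // => j' jj'.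
  by rewrite !mxE fb (inj_eq Some_inj) eq_sym (negPf jj') mulr0.
split; first by rewrite PMP !trmx_mul trmxK Mt mulmxA.
by move=> v; have := pM (P *m v); rewrite PMP trmx_mul !mulmxA.
Qed.

(* A label says how a coordinate is built from a matrix [X] on [p] vertices:
   [Some (Some i)] copies vertex [i], [Some None] is a vertex forced into the
   stable set, [None] a vertex forced out of it. *)
Definition label (p : nat) := option (option 'I_p).

(** A forced vertex meets a copied vertex [i] in [X i i] instead of [x i 0]: the two agree on
    feasible points, and the formula then also applies to matrices of [STAB2], which come without a
    vector. *)
Definition label_entry (R : pzRingType) p (X : 'M[R]_p) (a b : label p) : R :=
  match a, b with
  | Some (Some i), Some (Some j) => X i j
  | Some (Some i), Some None | Some None, Some (Some i) => X i i
  | Some None, Some None => 1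
  | _, _ => 0
  end.

Definition label_mx (R : pzRingType) p q (l : 'I_q -> label p) (X : 'M[R]_p) :
    'M[R]_q :=
  \matrix_(a, b) label_entry X (l a) (l b).

Definition label_col (R : pzRingType) p q (l : 'I_q -> label p) (x : 'cV[R]_p) :
    'cV[R]_q :=
  \col_a match l a with
         | Some (Some i) => x i 0
         | Some None => 1
         | None => 0
         end.

(** These are the pairs on which [label_entry] vanishes as soon as [X] vanishes on the edges of
    [H]. *)
Definition label_edge p (H : sgraph p) (a b : label p) : bool :=
  match a, b with
  | Some (Some i), Some (Some j) => H i j
  | Some _, Some _ => false
  | _, _ => true
  end.

Lemma theta_feasible_label (R : realType) p q (H : sgraph p) (K : sgraph q)
    (l : 'I_q -> label p) (X : 'M[R]_p) (x : 'cV[R]_p) :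
    (forall a b, K a b -> label_edge H (l a) (l b)) ->
  theta_feasible H X x -> theta_feasible K (label_mx l X) (label_col l x).
Proof.
move=> lK [pX dX eX]; split.
(* A forced vertex is sent to the border index: its row in the lift is the border row [(x^T, 1)].
   The bordered lift is thus a pullback of the bordered [X]. *)
- pose g (i : option 'I_p) := if i is Some i then lshift 1 i else rshift p 0.
  pose f (a : 'I_(q + 1)) : option 'I_(p + 1) :=
    if fintype.split a is inl a' then omap g (l a') else Some (rshift p 0).
  have fl a : f (lshift 1 a) = omap g (l a).
    by rewrite /f (unsplitK (inl _)).
  have fr a : f (rshift q a) = Some (rshift p 0).
    by rewrite /f (unsplitK (inr _)).
  suff -> : block_mx (label_mx l X) (label_col l x) (label_col l x)^T 1%:M =
            pull_mx f (block_mx X x x^T 1%:M) by exact: psd_pull_mx.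
  apply/matrixP=> a b; rewrite [RHS]mxE -[a]splitK -[b]splitK.
  case: (fintype.split a) => {}a; case: (fintype.split b) => {}b /=;
    rewrite ?fl ?fr /= ?ord1.
  - rewrite block_mxEul mxE.
    case: (l a) => [[i|]|] //=; case: (l b) => [[j|]|] //=;
      rewrite ?block_mxEul ?block_mxEur ?block_mxEdl ?block_mxEdr ?dX //.
      by rewrite mxE.
    by rewrite mxE eqxx.
  - rewrite block_mxEur mxE; case: (l a) => [[i|]|] //=;
      by rewrite ?block_mxEur ?block_mxEdr // mxE eqxx.
  - rewrite block_mxEdl !mxE; case: (l b) => [[i|]|] //=;
      by rewrite ?block_mxEdl ?block_mxEdr // mxE ?eqxx.
  - by rewrite !block_mxEdr.
- by move=> a; rewrite !mxE; case: (l a) => [[i|]|] /=.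
- move=> a b /lK; rewrite !mxE.
  case: (l a) => [[i|]|] //; case: (l b) => [[j|]|] //=.
  exact: eX.
Qed.

Lemma convex_STAB2 (R : realType) n (G : sgraph n) : convex_set (@STAB2 R n G).
Proof.
move=> X Y t /set_mem XG /set_mem YG; apply/mem_set => A [cA GA].
by apply/set_mem/cA; apply/mem_set; [apply: XG | apply: YG].
Qed.

(** The map [label_mx l] is affine and sends [s *m s^T] to the square of [label_col l s], because
    [s i 0 * s i 0 = s i 0] for 0/1 entries. So the preimage of [STAB2 K] is convex and contains the
    generators of [STAB2 H]. *)
Lemma STAB2_label (R : realType) p q (H : sgraph p) (K : sgraph q)
    (l : 'I_q -> label p) (X : 'M[R]_p) :
    (forall a b, K a b -> label_edge H (l a) (l b)) ->
  STAB2 H X -> STAB2 K (label_mx l X).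
Proof.
move=> lK.
suff: (@STAB2 R p H `<=` [set Y | STAB2 K (label_mx l Y)])%classic by apply.
apply: smallest_sub => [Y Z t /set_mem YK /set_mem ZK|Y [s [[s01 sH] ->]]].
  apply/mem_set => /=.
  have := @convex_STAB2 R q K _ _ t (mem_set YK) (mem_set ZK).
  move=> /set_mem; congr STAB2.
  apply/matrixP=> a b; rewrite !mxE.
  case: (l a) => [[i|]|]; case: (l b) => [[j|]|] //=;
    rewrite ?mxE ?mulr0 ?addr0 //.
  (* Two forced vertices give the constant entry 1, kept by convex combinations since the weights
     add up to 1. *)
  by rewrite !mulr1 unstable.add_onemK.
apply: sub_gen_smallest; exists (label_col l s); split.
  split=> [a|a b /lK]; rewrite !mxE.
    by case: (l a) => [[i|]|]; [exact: s01|right|left].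
  case: (l a) => [[i|]|]; case: (l b) => [[j|]|] //=; rewrite ?mul0r ?mulr0 //.
  exact: sH.
have ss i : s i 0 * s i 0 = s i 0.
  by case: (s01 i) => ->; rewrite ?mul0r ?mul1r.
apply/matrixP=> a b; rewrite !mxE !big_ord1 !mxE.
case: (l a) => [[i|]|]; case: (l b) => [[j|]|] //=;
  by rewrite ?mul0r ?mulr0 ?mul1r ?mulr1 // !mxE big_ord1 !mxE.
Qed.

Definition locate n (I : {set 'I_n}) (v : 'I_n) : option 'I_#|I| :=
  [pick i | enum_val i == v].

Lemma locate_enum_val n (I : {set 'I_n}) (i : 'I_#|I|) :
  locate I (enum_val i) = Some i.
Proof.
rewrite /locate; case: pickP => [j /eqP/enum_val_inj -> //|/(_ i)].
by rewrite eqxx.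
Qed.

Lemma locateP n (I : {set 'I_n}) v i : locate I v = Some i -> enum_val i = v.
Proof. by rewrite /locate; case: pickP => // j /eqP <- [->]. Qed.

Lemma locate_in n (I : {set 'I_n}) v : v \in I -> exists i, locate I v = Some i.
Proof.
move=> vI; exists (enum_rank_in vI v).
by rewrite -{1}(enum_rankK_in vI vI) locate_enum_val.
Qed.

Lemma locate_notin n (I : {set 'I_n}) v : v \notin I -> locate I v = None.
Proof.
by rewrite /locate; case: pickP => // i /eqP <-; rewrite enum_valP.
Qed.

(** Away from [ord0], [locate] fails exactly on the neighbors of [ord0], which are thereby forced
    out. *)
Definition local_label n (G : sgraph n.+1) (v : 'I_n.+1) :
    label #|local_vertices G| :=
  if v == ord0 then Some None else omap Some (locate (local_vertices G) v).

Lemma local_label_edge n (G : sgraph n.+1) v w :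
  G v w -> label_edge (local_graph G) (local_label G v) (local_label G w).
Proof.
have nb u : G ord0 u -> local_label G u = None.
  move=> Gu; rewrite /local_label ifN; last first.
    by apply: contraTneq Gu => ->; rewrite adj_irr.
  by rewrite locate_notin // !inE Gu orbT.
have [->|v0] := eqVneq v ord0.
  by move=> /nb ->; case: local_label => [[]|].
have [->|w0] := eqVneq w ord0.
  by rewrite adj_sym => /nb ->.
rewrite /local_label (negPf v0) (negPf w0).
case lv: locate => [i|] //=; case lw: locate => [j|] //=.
by rewrite (locateP lv) (locateP lw).
Qed.

Lemma sum_local_label (R : realType) n (G : sgraph n.+1)
    (x : 'cV[R]_#|local_vertices G|) :
  \sum_v label_col (local_label G) x v 0 = 1 + \sum_i x i 0.
Proof.
rewrite (bigD1 ord0) //= mxE /local_label eqxx; congr (_ + _).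
rewrite (bigID (mem (local_vertices G))) /= addrC big1 ?add0r; last first.
  by move=> v /andP[v0 vL]; rewrite mxE (negPf v0) locate_notin.
have inL v : v \in local_vertices G -> v != ord0.
  by rewrite !inE negb_or => /andP[].
rewrite (eq_bigl (mem (local_vertices G))) => [|v]; last first.
  by apply: andb_idl => /inL.
rewrite big_enum_val; apply: eq_bigr => i _.
by rewrite mxE (negPf (inL _ (enum_valP i))) locate_enum_val.
Qed.

Lemma esh_feasible_local_label (R : realType) k n (G : sgraph n.+1)
    (X : 'M[R]_#|local_vertices G|) (x : 'cV[R]_#|local_vertices G|) :
    esh_feasible (minn k #|local_vertices G|) (local_graph G) X x ->
  esh_feasible (minn k n.+1) G
    (label_mx (local_label G) X) (label_col (local_label G) x).
Proof.
set L := local_vertices G => -[tX sX]; split.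
  by apply: theta_feasible_label tX; apply: local_label_edge.
move=> I Ik; pose A := [set i : 'I_#|L| | enum_val i \in I]%SET.
(* The hypothesis on [X] concerns only sets of exactly [minn k #|L|] vertices, whereas [A] may be
   smaller, for instance when [I] contains [ord0] or its neighbors; so [A] is padded to [J]. *)
have [|J AJ Jk] := @exists_superset_card _ A (minn k #|L|).
  have AL : (#|A| <= #|L|)%N by have := max_card A; rewrite card_ord.
  rewrite card_ord geq_minr andbT leq_min AL andbT.
  rewrite -(card_imset _ (@enum_val_inj _ (mem L))).
  apply: (@leq_trans #|I|); last by rewrite Ik geq_minl.
  by apply/subset_leq_card/fintype.subsetP => _ /imsetP[i + ->]; rewrite inE.
(* Labels of [I] rewritten relative to [J]. The lookup in [J] never fails, as a copied vertex of [I]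
   lies in [A], hence in [J]; [lE] records this. *)
pose l (a : 'I_#|I|) : label #|J| :=
  match local_label G (enum_val a) with
  | Some (Some i) => omap Some (locate J i)
  | Some None => Some None
  | None => None
  end.
have lE a i : local_label G (enum_val a) = Some (Some i) ->
    exists2 j, l a = Some (Some j) & enum_val j = i.
  move=> lai; have iJ : i \in J.
    apply: (fintype.subsetP AJ); rewrite inE; move: lai; rewrite /local_label.
    case: eqP => // _; case lo: locate => [i'|] //= [<-].
    by rewrite (locateP lo) enum_valP.
  have [j lj] := locate_in iJ; exists j; first by rewrite /l lai lj.
  exact: locateP.
have l1 a : local_label G (enum_val a) = Some None -> l a = Some None.
  by rewrite /l => ->.
have l0 a : local_label G (enum_val a) = None -> l a = None.
  by rewrite /l => ->.
have -> : submx_on (label_mx (local_label G) X) I = label_mx l (submx_on X J).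
  apply/matrixP=> a b; rewrite !mxE.
  case ea: (local_label G (enum_val a)) => [[i|]|];
    [have [i' -> <-] := lE _ _ ea | rewrite (l1 _ ea) | rewrite (l0 _ ea)];
  case eb: (local_label G (enum_val b)) => [[j|]|];
    [have [j' -> <-] := lE _ _ eb | rewrite (l1 _ eb) | rewrite (l0 _ eb)
    |have [j' -> <-] := lE _ _ eb | rewrite (l1 _ eb) | rewrite (l0 _ eb)
    |have [j' -> <-] := lE _ _ eb | rewrite (l1 _ eb) | rewrite (l0 _ eb)];
  by rewrite /= ?mxE.
apply: STAB2_label (sX J Jk) => a b /local_label_edge.
case ea: (local_label G (enum_val a)) => [[i|]|];
  [have [i' -> <-] := lE _ _ ea | rewrite (l1 _ ea) | by rewrite (l0 _ ea)];
case eb: (local_label G (enum_val b)) => [[j|]|] //=;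
  by [have [j' -> <-] := lE _ _ eb | rewrite (l0 _ eb)].
Qed.

Theorem theorem19 (R : realType) (n : nat) (G : sgraph n.+1)
    (hG : vertex_transitive G) (k : nat) :
  (vt_esh R k G <= esh R k G)%R.
Proof.
(* Both [vt_esh] and [esh] cap the level at the order of the local graph; the two caps collapse into
   one. *)
rewrite /vt_esh {1}/esh -minnA minnn -lerBrDl.
(* Bounding a supremum by its upper bounds needs a nonempty set, since [sup] of the empty set is
   only a default value. *)
have [? _] :=
  has_sup_esh_values R (minn k #|local_vertices G|) (local_graph G).
apply: ge_sup => //.
move=> _ [X [x [fX ->]]]; rewrite lerBrDl -sum_local_label.
apply: ub_le_sup; first by have [] := has_sup_esh_values R (minn k n.+1) G.
exists (label_mx (local_label G) X), (label_col (local_label G) x).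
by split=> //; apply: esh_feasible_local_label.
Qed.
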